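(* Let $V$ be a diffeological vector space over a diffeological field $\mathbb{K}$ such that the smooth dual $V'$ separates the points of $V$. Then the power series tensor algebra $(T^\otimes((V)),+,\otimes)$ defined by $$T^\otimes((V)) = \mathbb{K} \oplus \prod_{k \ge 1} V^{\otimes k},$$ equipped with the infinite product diffeology, is a diffeological $\mathbb{K}$-algebra. Moreover its group of units is $$T^\otimes((V))^{\times} = \{\lambda + t \;:\; \lambda\in\mathbb{K}\setminus\{0\},\ t\in \prod_{k\ge 1}V^{\otimes k}\},$$ and $T^\otimes((V))^{\times}$ is a diffeological group for the subset diffeology inherited from $T^\otimes((V))$.
   Context: A diffeology on a set $X$ is a set of maps (plots) $p:U\to X$, with $U$ an open subset of some Euclidean space, which contains all constant maps, is local (a map that is locally a plot is a plot), and is stable under precomposition with smooth maps between open subsets of Euclidean spaces. A map between diffeological spaces is smooth if it sends plots to plots by composition. The D-topology of $X$ is the finest topology making all plots continuous. The subset diffeology on $Y\subseteq X$ consists of the plots of $X$ with image in $Y$. Plots of a product with the product diffeology are the maps all of whose components are plots. A diffeological field $\mathbb{K}$ is a field with a diffeology such that addition and multiplication are smooth, $\mathbb{K}^*=\mathbb{K}\setminus\{0\}$ is open for the D-topology, inversion $\mathbb{K}^*\to\mathbb{K}^*$ is smooth, and $\mathbb{R}\subset\mathbb{K}$ is a diffeological subfield. A diffeological vector space over $\mathbb{K}$ is a $\mathbb{K}$-vector space with a diffeology making addition and scalar multiplication smooth. A diffeological algebra is an algebra with a diffeology making addition, multiplication and scalar multiplication smooth. A diffeological group is a group with a diffeology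 making multiplication and inversion smooth. $V'$ is the space of smooth $\mathbb{K}$-linear forms on $V$; it separates $V$ if for all $v\neq w$ in $V$ there is $\alpha\in V'$ with $\alpha(v)\ne\alpha(w)$. For diffeological vector spaces $V,W$, let $B(V,W)$ be the space of smooth bilinear forms on $V\times W$ with the functional diffeology; $V\otimes W$ is the linear span, in the smooth dual $B(V,W)'$, of the elements $v\otimes w: b\mapsto b(v,w)$. Plots of $V\otimes W$ are the maps which locally, on an open set $U$, have the form $\sum_{k=1}^n v_k\otimes w_k$ for some $n$ and smooth $v_k:U\to V$, $w_k:U\to W$. The powers $V^{\otimes n}$ are defined by induction, $V^{\otimes 1}=V$, $V^{\otimes (n+1)}=V\otimes V^{\otimes n}$; plots of $V^{\otimes n}$ are locally finite sums $\sum_k v^1_k\otimes\cdots\otimes v^n_k$ with each $v^i_k:U\to V$ smooth. The product $\otimes$ on $T^\otimes((V))$ is the Cauchy product: the degree-$n$ component of $a\otimes b$ is $\sum_{i+j=n}a_i\otimes b_j$, where $V^{\otimes 0}=\mathbb{K}$, tensoring with a degree-$0$ element is scalar multiplication, and $V^{\otimes i}\times V^{\otimes j}\to V^{\otimes(i+j)}$ is induced by concatenation. *)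

(* Defs.v *)
From HB Require Import structures.
From mathcomp Require Import all_boot all_order all_algebra.
From mathcomp Require Import all_classical all_reals all_analysis.
Set Implicit Arguments.
Unset Strict Implicit.
Unset Printing Implicit Defensive.
Import Order.TTheory GRing.Theory Num.Theory.
Import numFieldNormedType.Exports.
Local Open Scope classical_set_scope.
Local Open Scope ring_scope.

Section EuclideanSmoothness.
Variable R : realType.

(* For k > 0, [Ck k U f] asks f to be differentiable on U with all its
   directional derivatives of class C^(k-1); only the values of f near U
   matter, so a total f represents a map on the open set U. *)
Fixpoint Ck (n : nat) (W : normedModType R) (k : nat) (U : set 'rV[R]_n)
    (f : 'rV[R]_n -> W) : Prop :=
  if k is k'.+1 then
    (forall x, U x -> differentiable f x) /\
    (forall v : 'rV[R]_n, Ck k' U ('D_v f))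
  else forall x, U x -> {for x, continuous f}.

Definition Cinfty (n : nat) (W : normedModType R) (U : set 'rV[R]_n)
    (f : 'rV[R]_n -> W) : Prop := forall k, Ck k U f.

Lemma near_differentiable (V W : normedModType R) (f g : V -> W) x :
  (\forall y \near x, f y = g y) -> differentiable f x -> differentiable g x.
Proof.
move=> fg df; suff dh : differentiable (g \- f) x.
  have -> : g = f \+ (g \- f) by apply/funext => y /=; rewrite addrC subrK.
  exact: differentiableD.
have hx : \forall y \near x, (g \- f) y = 0.
  by apply: filterS fg => y /= ->; rewrite subrr.
have c0 : continuous (\0 : V -> W) by exact: cst_continuous.
have e0 : (g \- f) \o shift x = cst ((g \- f) x) + \0 +o_ 0 id.
  apply/eqaddoP => _/posnumP[e]; have := hx; rewrite (near_shift 0) subr0.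
  apply: filterS => y /= hy.
  have -> : ((g \- f) \o shift x - (cst ((g \- f) x) + \0)) y = 0.
    change ((g \- f) (y + x) - ((g \- f) x + 0) = 0).
    have h0 : (g \- f) x = 0 := nbhs_singleton hx.
    by rewrite [X in X - _]hy h0 addr0 subrr.
  by rewrite normr0 mulr_ge0.
apply/diff_locallyP.
have d0 : 'd (g \- f) x = \0 :> (V -> W) by exact: diff_unique.
by rewrite d0.
Qed.

Lemma Ck_ext n (W : normedModType R) k (U : set 'rV[R]_n) (f g : 'rV[R]_n -> W) :
  open U -> (forall x, U x -> f x = g x) -> Ck k U f -> Ck k U g.
Proof.
move=> oU.
have nearU x (P : set 'rV[R]_n) : U x -> (U `<=` P) -> \forall y \near x, P y.
  move=> Ux UP; have : nbhs x U by apply: open_nbhs_nbhs; split.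
  exact: filterS.
elim: k f g => [|k IH] f g fg /=.
  move=> cf x Ux; have cfx : f y @[y --> x] --> f x := cf _ Ux.
  change (g y @[y --> x] --> g x); rewrite -(fg _ Ux).
  apply: cvg_trans cfx; apply: (@near_eq_cvg _ _ (nbhs x)).
  by apply: nearU => // y; exact: fg.
have nfg z : U z -> \forall y \near z, f y = g y.
  by move=> Ux; apply: nearU => // y; exact: fg.
case=> df Df; split.
  by move=> x Ux; apply: near_differentiable (nfg _ Ux) _; exact: df.
move=> v; apply: IH (Df v) => x Ux.
exact: near_eq_derive (nfg _ Ux).
Qed.

Lemma CkW n (W : normedModType R) k (U : set 'rV[R]_n) (f : 'rV[R]_n -> W) :
  Ck k.+1 U f -> Ck k U f.
Proof.
elim: k f => [|k IH] f.
  by case=> df _ x Ux; apply: differentiable_continuous; exact: df.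
by case=> df Df; split=> // v; apply: IH.
Qed.

Lemma Ck_sub n (W : normedModType R) k (U U' : set 'rV[R]_n) (f : 'rV[R]_n -> W) :
  U' `<=` U -> Ck k U f -> Ck k U' f.
Proof.
move=> UU'; elim: k f => [|k IH] f /=; first by move=> cf x /UU'; exact: cf.
by case=> df Df; split=> [x /UU'|v]; [exact: df | exact: IH].
Qed.

Lemma Ck_cst n (W : normedModType R) k (U : set 'rV[R]_n) (w : W) :
  Ck k U (fun=> w).
Proof.
elim: k w => [|k IH] w /=; first by move=> x _; exact: cst_continuous.
split=> [x _|v]; first exact: differentiable_cst.
have -> : 'D_v (fun=> w) = (fun=> 0) :> ('rV[R]_n -> W).
  by apply/funext => x; rewrite derive_cst.
exact: IH.
Qed.

Lemma CkD n (W : normedModType R) k (U : set 'rV[R]_n) (f g : 'rV[R]_n -> W) :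
  open U -> Ck k U f -> Ck k U g -> Ck k U (f \+ g).
Proof.
move=> oU; elim: k f g => [|k IH] f g /=.
  by move=> cf cg x Ux; apply: continuousD; [exact: cf|exact: cg].
case=> df Df [dg Dg]; split=> [x Ux|v].
  by apply: differentiableD; [exact: df|exact: dg].
apply: Ck_ext (IH _ _ (Df v) (Dg v)) => // x Ux /=.
by rewrite deriveD//; apply: diff_derivable; [exact: df|exact: dg].
Qed.

Lemma Ck_sum n (W : normedModType R) k (U : set 'rV[R]_n) m
    (f : 'I_m -> 'rV[R]_n -> W) :
  open U -> (forall i, Ck k U (f i)) -> Ck k U (fun x => \sum_i f i x).
Proof.
move=> oU; elim: m f => [|m IH] f cf.
  apply: (Ck_ext oU _ (Ck_cst k U (0 : W))) => x _; by rewrite big_ord0.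
apply: (Ck_ext oU _ (CkD oU (IH _ (fun i => cf (widen_ord (leqnSn m) i))) (cf ord_max))).
by move=> x _ /=; rewrite big_ord_recr.
Qed.

Lemma Ck_lin n (W W' : normedModType R) (L : {linear W -> W'}) k
    (U : set 'rV[R]_n) (f : 'rV[R]_n -> W) :
  open U -> continuous L -> Ck k U f -> Ck k U (L \o f).
Proof.
move=> oU cL; elim: k f => [|k IH] f /=.
  by move=> cf x Ux; apply: continuous_comp; [exact: cf|exact: cL].
case=> df Df; split=> [x Ux|v].
  apply: differentiable_comp; first exact: df.
  exact: linear_differentiable.
apply: Ck_ext (IH _ (Df v)) => // x Ux /=.
have dL y : differentiable L y by exact: linear_differentiable.
have dLf := differentiable_comp (df _ Ux) (dL (f x)).
rewrite (deriveE v (df _ Ux)) [in RHS](deriveE v dLf).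
by rewrite (diff_comp (df _ Ux) (dL _)) diff_lin.
Qed.

Let scale_bilin (W : normedModType R) : bilinear_for
    (GRing.Scale.Law.clone _ _ *:%R _) (GRing.Scale.Law.clone _ _ *:%R _)
    (@GRing.scale R W : R^o -> W -> W).
Proof.
split=> [w|r] a x y /=.
- by rewrite scalerDl scalerA.
- by rewrite scalerDr !scalerA mulrC.
Qed.
HB.instance Definition _ (W : normedModType R) :=
  bilinear_isBilinear.Build R R^o W W _ _ (@GRing.scale R W : R^o -> W -> W) (scale_bilin W).

Lemma CkZ n (W : normedModType R) k (U : set 'rV[R]_n)
    (a : 'rV[R]_n -> R^o) (f : 'rV[R]_n -> W) :
  open U -> Ck k U a -> Ck k U f -> Ck k U (fun x => (a x : R) *: f x).
Proof.
move=> oU; elim: k a f => [|k IH] a f /=.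
  move=> ca cf x Ux; have cax : a y @[y --> x] --> a x := ca _ Ux.
  have cfx : f y @[y --> x] --> f x := cf _ Ux.
  exact: (cvgZ cax cfx).
move=> Ca Cf.
have [da Da] := Ca; have [df Df] := Cf.
pose B := (@GRing.scale R W : R^o -> W -> W).
have cB : continuous (fun p => B p.1 p.2) by exact: scale_continuous.
have dB x : differentiable (fun p => B p.1 p.2) x by exact: differentiable_bilin.
have dP x : U x -> differentiable (fun y => (a y, f y)) x.
  by move=> Ux; apply: differentiable_pair; [exact: da|exact: df].
split=> [x Ux|v].
  exact: (differentiable_comp (dP x Ux) (dB _)).
apply: Ck_ext (CkD oU (IH _ _ (CkW Ca) (Df v)) (IH _ _ (Da v) (CkW Cf))) => //.
move=> x Ux; have dBP := differentiable_comp (dP x Ux) (dB _).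
rewrite [RHS](deriveE v dBP) (diff_comp (dP x Ux) (dB _)) /=.
rewrite (diff_bilin _ cB) (diff_pair (da _ Ux) (df _ Ux)) /=.
by rewrite /B (deriveE v (da _ Ux)) (deriveE v (df _ Ux)).
Qed.

Lemma Ck_comp n m (W : normedModType R) k (U : set 'rV[R]_n) (U' : set 'rV[R]_m)
    (f : 'rV[R]_n -> 'rV[R]_m) (g : 'rV[R]_m -> W) :
  open U -> (forall x, U x -> U' (f x)) ->
  Ck k U f -> Ck k U' g -> Ck k U (g \o f).
Proof.
move=> oU fU; elim: k f g fU => [|k IH] f g fU /=.
  move=> cf cg x Ux; apply: continuous_comp; first exact: cf.
  by apply: cg; exact: fU.
move=> Cf [dg Dg]; have [df Df] := Cf.
split=> [x Ux|v].
  by apply: differentiable_comp; [exact: df|exact/dg/fU].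
have C1 : Ck k U (fun x => \sum_(j < m)
    ('D_v f x 0 j : R) *: ('D_(delta_mx 0 j) g \o f) x).
  apply: Ck_sum => // j.
  apply: (@CkZ _ _ _ _ (fun x => 'D_v f x 0 j : R^o)) => //.
    pose f0 (N : 'rV[R]_m) : R^o := N 0 j.
    have f0l : linear f0 by move=> ? ? ?; rewrite /f0 !mxE.
    pose L : {linear 'rV[R]_m -> R^o} :=
      HB.pack f0 (GRing.isLinear.Build _ _ _ _ _ f0l).
    have : Ck k U (L \o 'D_v f).
      by apply: Ck_lin => //; exact: coord_continuous.
    by [].
  by apply: (IH _ _ fU) => //; exact: CkW.
apply: Ck_ext C1 => // x Ux /=.
have dgx := dg _ (fU _ Ux).
rewrite (deriveE v (differentiable_comp (df _ Ux) dgx)).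
rewrite (diff_comp (df _ Ux) dgx) /= -(deriveE v (df _ Ux)).
rewrite [in RHS](row_sum_delta ('D_v f x)) linear_sum.
by apply: eq_bigr => j _; rewrite linearZ /= (deriveE _ dgx).
Qed.

Lemma Cinfty_comp n m (W : normedModType R) (U : set 'rV[R]_n) (U' : set 'rV[R]_m)
    (f : 'rV[R]_n -> 'rV[R]_m) (g : 'rV[R]_m -> W) :
  open U -> (forall x, U x -> U' (f x)) ->
  Cinfty U f -> Cinfty U' g -> Cinfty U (g \o f).
Proof. by move=> oU fU Cf Cg k; exact: (Ck_comp oU fU (Cf k) (Cg k)). Qed.

Lemma Cinfty_id n (U : set 'rV[R]_n) : Cinfty U (@id 'rV[R]_n).
Proof.
case=> [|k] /=; first by move=> x _; exact: cvg_id.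
split=> [x _|v].
  exact: ex_diff.
have -> : 'D_v (@id 'rV[R]_n) = (fun=> v) by apply/funext => x; rewrite derive_id.
exact: Ck_cst.
Qed.

End EuclideanSmoothness.

(* A plot [p : U -> X], with U open in R^n, is represented by a total function
   on R^n of which only the values on U are meaningful ([plot_ext]). *)
HB.mixin Record isDiffeological (R : realType) (X : Type) := {
  plot : forall n : nat, set 'rV[R]_n -> ('rV[R]_n -> X) -> Prop;
  plot_open : forall n (U : set 'rV[R]_n) (p : 'rV[R]_n -> X), plot _ U p -> open U;
  plot_ext : forall n (U : set 'rV[R]_n) p q,
    (forall x, U x -> p x = q x) -> plot _ U p -> plot _ U q;
  plot_cst : forall n (U : set 'rV[R]_n) (a : X), open U -> plot _ U (fun=> a);
  plot_local : forall n (U : set 'rV[R]_n) p, open U ->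
    (forall x, U x -> exists U', [/\ U' x, U' `<=` U & plot _ U' p]) -> plot _ U p;
  plot_comp : forall m n (U : set 'rV[R]_m) (U' : set 'rV[R]_n)
      (f : 'rV[R]_m -> 'rV[R]_n) p,
    open U -> Cinfty U f -> (forall x, U x -> U' (f x)) ->
    plot _ U' p -> plot _ U (p \o f)
}.

#[short(type="diffType")]
HB.structure Definition Diffeological (R : realType) :=
  {X of isDiffeological R X}.

Arguments plot {R} s {n} U p : rename.
Arguments plot_open {R s n U p} : rename.
Arguments plot_ext {R s n U p q} : rename.
Arguments plot_cst {R s n U} a : rename.
Arguments plot_local {R s n U p} : rename.
Arguments plot_comp {R s m n U U' f p} : rename.

Section DiffeologicalSpaces.
Variable R : realType.

Lemma plot_sub (X : diffType R) n (U U' : set 'rV[R]_n) (p : 'rV[R]_n -> X) :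
  open U' -> U' `<=` U -> plot X U p -> plot X U' p.
Proof.
move=> oU' sU pU; rewrite -[p]/(p \o id).
exact: (plot_comp oU' (@Cinfty_id _ _ _) sU pU).
Qed.

Definition smooth (X Y : diffType R) (f : X -> Y) : Prop :=
  forall n (U : set 'rV[R]_n) (p : 'rV[R]_n -> X), plot X U p -> plot Y U (f \o p).

Lemma open_preimage_smooth m n (U : set 'rV[R]_m) (U' : set 'rV[R]_n)
    (f : 'rV[R]_m -> 'rV[R]_n) : open U -> Cinfty U f -> open U' ->
  open (U `&` f @^-1` U') /\ U `&` f @^-1` U' `<=` U.
Proof.
move=> oU Cf oU'; split; last by move=> x [].
rewrite openE => y [Uy U'y]; apply: filterI.
  by apply: open_nbhs_nbhs; split.
have cf : f z @[z --> y] --> f y := Cf 0%N y Uy.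
by apply: cf; apply: open_nbhs_nbhs; split.
Qed.

(* Openness for the D-topology, the final topology of the plots. *)
Definition D_open (X : diffType R) (A : set X) : Prop :=
  forall n (U : set 'rV[R]_n) (p : 'rV[R]_n -> X), plot X U p -> open (U `&` p @^-1` A).

End DiffeologicalSpaces.

Section SubsetDiffeology.
Variables (R : realType) (X : diffType R) (A : set X).

Definition subset_plot n (U : set 'rV[R]_n) (p : 'rV[R]_n -> A) : Prop :=
  plot X U (fun x => val (p x)).

Let sub_open n (U : set 'rV[R]_n) p : subset_plot U p -> open U.
Proof. exact: plot_open. Qed.

Let sub_ext n (U : set 'rV[R]_n) p q :
  (forall x, U x -> p x = q x) -> subset_plot U p -> subset_plot U q.
Proof. by move=> pq; apply: plot_ext => x Ux; rewrite pq. Qed.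

Let sub_cst n (U : set 'rV[R]_n) (a : A) : open U -> subset_plot U (fun=> a).
Proof. by move=> oU; exact: plot_cst. Qed.

Let sub_local n (U : set 'rV[R]_n) p : open U ->
    (forall x, U x -> exists U', [/\ U' x, U' `<=` U & subset_plot U' p]) ->
  subset_plot U p.
Proof. by move=> oU pU; exact: plot_local. Qed.

Let sub_comp m n (U : set 'rV[R]_m) (U' : set 'rV[R]_n)
    (f : 'rV[R]_m -> 'rV[R]_n) p :
  open U -> Cinfty U f -> (forall x, U x -> U' (f x)) ->
  subset_plot U' p -> subset_plot U (p \o f).
Proof.
by move=> oU Cf fU pU; exact: (plot_comp (p := fun x => val (p x)) oU Cf fU pU).
Qed.

HB.instance Definition _ := isDiffeological.Build R (set_type A)
  sub_open sub_ext sub_cst sub_local sub_comp.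

End SubsetDiffeology.

Section ProductDiffeology.
Variables (R : realType) (X Y : diffType R).

Definition prod_plot n (U : set 'rV[R]_n) (p : 'rV[R]_n -> X * Y) : Prop :=
  plot X U (fst \o p) /\ plot Y U (snd \o p).

Let prod_open n (U : set 'rV[R]_n) p : prod_plot U p -> open U.
Proof. by case=> /plot_open. Qed.

Let prod_ext n (U : set 'rV[R]_n) p q :
  (forall x, U x -> p x = q x) -> prod_plot U p -> prod_plot U q.
Proof.
move=> pq [p1 p2]; split; [move: p1|move: p2]; apply: plot_ext => x Ux /=;
  by rewrite pq.
Qed.

Let prod_cst n (U : set 'rV[R]_n) a : open U -> prod_plot U (fun=> a).
Proof. by move=> oU; split; exact: plot_cst. Qed.

Let prod_local n (U : set 'rV[R]_n) p : open U ->
    (forall x, U x -> exists U', [/\ U' x, U' `<=` U & prod_plot U' p]) ->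
  prod_plot U p.
Proof.
move=> oU pU; split; apply: plot_local => // x /pU [U' [U'x sU [? ?]]];
  by exists U'.
Qed.

Let prod_comp m n (U : set 'rV[R]_m) (U' : set 'rV[R]_n)
    (f : 'rV[R]_m -> 'rV[R]_n) p :
  open U -> Cinfty U f -> (forall x, U x -> U' (f x)) ->
  prod_plot U' p -> prod_plot U (p \o f).
Proof.
move=> oU Cf fU [p1 p2]; split.
  exact: (plot_comp oU Cf fU p1).
exact: (plot_comp oU Cf fU p2).
Qed.

HB.instance Definition _ := isDiffeological.Build R (X * Y)%type
  prod_open prod_ext prod_cst prod_local prod_comp.

End ProductDiffeology.

Section InfiniteProductDiffeology.
Variables (R : realType) (I : Type) (X : I -> diffType R).

Definition dprod_plot n (U : set 'rV[R]_n) (p : 'rV[R]_n -> forall i, X i) : Prop :=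
  open U /\ forall i, plot (X i) U (fun x => p x i).

Lemma dprod_open n (U : set 'rV[R]_n) p : dprod_plot U p -> open U.
Proof. by case. Qed.

Lemma dprod_ext n (U : set 'rV[R]_n) p q :
  (forall x, U x -> p x = q x) -> dprod_plot U p -> dprod_plot U q.
Proof.
move=> pq [oU pU]; split=> // i; apply: plot_ext (pU i) => x Ux.
by rewrite pq.
Qed.

Lemma dprod_cst n (U : set 'rV[R]_n) a : open U -> dprod_plot U (fun=> a).
Proof. by move=> oU; split=> // i; exact: plot_cst. Qed.

Lemma dprod_local n (U : set 'rV[R]_n) p : open U ->
    (forall x, U x -> exists U', [/\ U' x, U' `<=` U & dprod_plot U' p]) ->
  dprod_plot U p.
Proof.
move=> oU pU; split=> // i; apply: plot_local => // x /pU [U' [U'x sU [_ ?]]].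
by exists U'; split.
Qed.

Lemma dprod_comp m n (U : set 'rV[R]_m) (U' : set 'rV[R]_n)
    (f : 'rV[R]_m -> 'rV[R]_n) p :
  open U -> Cinfty U f -> (forall x, U x -> U' (f x)) ->
  dprod_plot U' p -> dprod_plot U (p \o f).
Proof.
move=> oU Cf fU [_ pU]; split=> // i.
exact: (plot_comp (p := fun x => p x i) oU Cf fU (pU i)).
Qed.

End InfiniteProductDiffeology.

Section FunctionalDiffeology.
Variables (R : realType) (X Y : diffType R) (F : Type) (ev : F -> X -> Y).
Hypothesis ev_smooth : forall a, smooth (ev a).

(* p is a plot iff [(u, x) |-> ev (p u) x] is smooth on U * X; the plots of the
   product U * X are the pairs of a smooth map into U and a plot of X. *)
Definition fun_plot n (U : set 'rV[R]_n) (p : 'rV[R]_n -> F) : Prop :=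
  open U /\
  forall m (U' : set 'rV[R]_m) (f : 'rV[R]_m -> 'rV[R]_n) (q : 'rV[R]_m -> X),
    Cinfty U' f -> (forall x, U' x -> U (f x)) -> plot X U' q ->
    plot Y U' (fun x => ev (p (f x)) (q x)).

Lemma fun_open n (U : set 'rV[R]_n) p : fun_plot U p -> open U.
Proof. by case. Qed.

Lemma fun_ext n (U : set 'rV[R]_n) p q :
  (forall x, U x -> p x = q x) -> fun_plot U p -> fun_plot U q.
Proof.
move=> pq [oU pU]; split=> // m U' f r Cf fU rU.
by apply: plot_ext (pU _ _ _ _ Cf fU rU) => x U'x; rewrite pq//; exact: fU.
Qed.

Lemma fun_cst n (U : set 'rV[R]_n) a : open U -> fun_plot U (fun=> a).
Proof. by move=> oU; split=> // m U' f q _ _ qU; exact: ev_smooth. Qed.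

Lemma fun_local n (U : set 'rV[R]_n) p : open U ->
    (forall x, U x -> exists U', [/\ U' x, U' `<=` U & fun_plot U' p]) ->
  fun_plot U p.
Proof.
move=> oU pU; split=> // m U' f q Cf fU qU; have oU' := plot_open qU.
apply: plot_local => // x U'x; have [U1 [U1x sU [oU1 pU1]]] := pU _ (fU _ U'x).
exists (U' `&` f @^-1` U1); have sU' : U' `&` f @^-1` U1 `<=` U' by move=> ? [].
have [oU2 _] := open_preimage_smooth oU' Cf oU1.
split=> //; apply: pU1 => //; last exact: plot_sub qU.
  by move=> k; apply: Ck_sub sU' _; exact: Cf.
by move=> y [].
Qed.

Lemma fun_comp m n (U : set 'rV[R]_m) (U' : set 'rV[R]_n)
    (f : 'rV[R]_m -> 'rV[R]_n) p :
  open U -> Cinfty U f -> (forall x, U x -> U' (f x)) ->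
  fun_plot U' p -> fun_plot U (p \o f).
Proof.
move=> oU Cf fU [_ pU]; split=> // k V g q Cg gU qV.
apply: (pU _ _ (f \o g)) => //; last by move=> x Vx; exact/fU/gU.
exact: Cinfty_comp (plot_open qV) gU Cg Cf.
Qed.

End FunctionalDiffeology.

#[short(type="diffZmodType")]
HB.structure Definition DiffZmodule (R : realType) :=
  {V of GRing.Zmodule V & isDiffeological R V}.

#[short(type="diffLmodType")]
HB.structure Definition DiffLmodule (R : realType) (K : pzRingType) :=
  {V of GRing.Lmodule K V & isDiffeological R V}.

#[short(type="preDiffFieldType")]
HB.structure Definition PreDiffField (R : realType) :=
  {K of GRing.Field K & isDiffeological R K}.

Definition nonzero (K : fieldType) : set K := [set x | x != 0].
Arguments nonzero K : clear implicits.

Definition nonzero_inv (K : fieldType) (x : nonzero K) : nonzero K :=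
  SigSub (mem_set (invr_neq0 (set_valP x)) : (val x)^-1 \in nonzero K).

(* [real_embedding] is the inclusion of the reals as a diffeological subfield:
   by [real_embedding_plot] it identifies the standard diffeology of R with the
   subset diffeology of its image. *)
HB.mixin Record isDiffField (R : realType) (K : Type) of PreDiffField R K := {
  field_add_smooth : smooth (fun x : K * K => x.1 + x.2);
  field_mul_smooth : smooth (fun x : K * K => x.1 * x.2);
  field_nonzero_open : D_open (nonzero K);
  field_inv_smooth : smooth (@nonzero_inv K);
  real_embedding : {rmorphism R -> K};
  real_embedding_plot : forall n (U : set 'rV[R]_n) (f : 'rV[R]_n -> R),
    plot K U (real_embedding \o f) <-> (open U /\ Cinfty U (f : _ -> R^o))
}.

#[short(type="diffFieldType")]
HB.structure Definition DiffField (R : realType) :=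
  {K of PreDiffField R K & isDiffField R K}.

HB.mixin Record isDiffVect (R : realType) (K : diffFieldType R) (V : Type)
    of DiffLmodule R K V := {
  vadd_smooth : smooth (fun x : V * V => x.1 + x.2);
  vscale_smooth : smooth (fun x : K * V => x.1 *: x.2)
}.

#[short(type="diffVectType")]
HB.structure Definition DiffVect (R : realType) (K : diffFieldType R) :=
  {V of isDiffVect R K V & DiffLmodule R K V}.

HB.instance Definition _ (R : realType) (K : diffFieldType R) :=
  Diffeological.copy K^o K.
HB.instance Definition _ (R : realType) (K : diffFieldType R) :=
  isDiffVect.Build R K K^o field_add_smooth field_mul_smooth.

Section SmoothMaps.
Variables (R : realType) (K : diffFieldType R).

Lemma smooth_comp (X Y Z : diffType R) (f : X -> Y) (g : Y -> Z) :
  smooth f -> smooth g -> smooth (g \o f).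
Proof. by move=> sf sg n U p /sf /sg. Qed.

Lemma smooth_pair (X Y Z : diffType R) (f : X -> Y) (g : X -> Z) :
  smooth f -> smooth g -> smooth (fun x => (f x, g x)).
Proof. by move=> sf sg n U p pU; split; [exact: sf|exact: sg]. Qed.

Lemma smooth_cst (X Y : diffType R) (y : Y) : smooth (fun _ : X => y).
Proof. by move=> n U p pU; apply: plot_cst; exact: plot_open pU. Qed.

Lemma smoothD (X : diffType R) (W : diffVectType K) (f g : X -> W) :
  smooth f -> smooth g -> smooth (fun x => f x + g x).
Proof.
by move=> sf sg; exact: (smooth_comp (smooth_pair sf sg) (@vadd_smooth _ _ W)).
Qed.

Lemma smoothZ (X : diffType R) (W : diffVectType K) (a : X -> K) (f : X -> W) :
  smooth a -> smooth f -> smooth (fun x => a x *: f x).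
Proof.
by move=> sf sg; exact: (smooth_comp (smooth_pair sf sg) (@vscale_smooth _ _ W)).
Qed.

Lemma plotD (W : diffVectType K) n (U : set 'rV[R]_n) (f g : 'rV[R]_n -> W) :
  plot W U f -> plot W U g -> plot W U (fun x => f x + g x).
Proof.
move=> pf pg; exact: (@vadd_smooth _ _ W _ U (fun x => (f x, g x)) (conj pf pg)).
Qed.

Lemma plotZ (W : diffVectType K) n (U : set 'rV[R]_n) (a : 'rV[R]_n -> K)
    (f : 'rV[R]_n -> W) :
  plot K U a -> plot W U f -> plot W U (fun x => a x *: f x).
Proof.
move=> pa pf; exact: (@vscale_smooth _ _ W _ U (fun x => (a x, f x)) (conj pa pf)).
Qed.

End SmoothMaps.

Section SmoothLinear.
Variables (R : realType) (K : diffFieldType R) (V W : diffVectType K).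

Definition smooth_linear : {pred V -> W} :=
  fun f => `[< linear f /\ smooth f >].

Record slin := Slin { slin_fun :> V -> W ; _ : slin_fun \in smooth_linear }.

HB.instance Definition _ := [isSub for slin_fun].
HB.instance Definition _ := [Choice of slin by <:].

Lemma smooth_linear_submod : submod_closed smooth_linear.
Proof.
split=> [|a f g /asboolP[lf sf] /asboolP[lg sg]].
  apply/asboolP; split; last exact: smooth_cst.
  by move=> a x y /=; rewrite scaler0 addr0.
apply/asboolP; split=> [b x y|].
  change (a *: f (b *: x + y) + g (b *: x + y) =
    b *: (a *: f x + g x) + (a *: f y + g y)).
  rewrite lf lg !scalerDr !scalerA [a * b]mulrC -!addrA; congr (_ + _).
  by rewrite addrCA.
by apply: smoothD => //; apply: smoothZ => //; exact: smooth_cst.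
Qed.

HB.instance Definition _ :=
  GRing.isSubmodClosed.Build K (V -> W) smooth_linear smooth_linear_submod.
HB.instance Definition _ := [SubChoice_isSubLmodule of slin by <:].

Lemma slin_linear (f : slin) : linear f.
Proof. by case: f => f /= /asboolP[]. Qed.

Lemma slin_smooth (f : slin) : smooth f.
Proof. by case: f => f /= /asboolP[]. Qed.

HB.instance Definition _ (f : slin) :=
  GRing.isLinear.Build K V W _ (slin_fun f) (slin_linear f).

Definition mk_slin (f : V -> W) (lf : linear f) (sf : smooth f) : slin :=
  @Slin f (asboolT (conj lf sf)).

End SmoothLinear.

(* [slin V K^o] is the smooth dual V'. *)
Definition separates_points (R : realType) (K : diffFieldType R) (V : diffVectType K) :=
  forall v w : V, v <> w -> exists a : slin V K^o, a v <> a w.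

Section SmoothBilinear.
Variables (R : realType) (K : diffFieldType R) (V W : diffVectType K).

Definition smooth_bilinear : {pred V * W -> K^o} :=
  fun b => `[< [/\ forall w, linear (fun v => b (v, w)),
                  forall v, linear (fun w => b (v, w)) & smooth b] >].

Record bform := BForm {
  bform_fun :> V * W -> K^o ; _ : bform_fun \in smooth_bilinear }.

HB.instance Definition _ := [isSub for bform_fun].
HB.instance Definition _ := [Choice of bform by <:].

Lemma smooth_bilinear_submod : submod_closed smooth_bilinear.
Proof.
split=> [|a f g /asboolP[lf rf sf] /asboolP[lg rg sg]].
  apply/asboolP; split; last exact: smooth_cst.
    by move=> w a x y /=; rewrite scaler0 addr0.
  by move=> w a x y /=; rewrite scaler0 addr0.
apply/asboolP; split=> [w b x y|w b x y|].
- change (a *: f (b *: x + y, w) + g (b *: x + y, w) =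
    b *: (a *: f (x, w) + g (x, w)) + (a *: f (y, w) + g (y, w))).
  rewrite lf lg !scalerDr !scalerA [a * b]mulrC -!addrA; congr (_ + _).
  by rewrite addrCA.
- change (a *: f (w, b *: x + y) + g (w, b *: x + y) =
    b *: (a *: f (w, x) + g (w, x)) + (a *: f (w, y) + g (w, y))).
  rewrite rf rg !scalerDr !scalerA [a * b]mulrC -!addrA; congr (_ + _).
  by rewrite addrCA.
by apply: smoothD => //; apply: smoothZ => //; exact: smooth_cst.
Qed.

HB.instance Definition _ :=
  GRing.isSubmodClosed.Build K (V * W -> K^o) smooth_bilinear smooth_bilinear_submod.
HB.instance Definition _ := [SubChoice_isSubLmodule of bform by <:].

Lemma bform_smooth (b : bform) : smooth b.
Proof. by case: b => b /= /asboolP[]. Qed.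

Lemma bform_linl (b : bform) w : linear (fun v => b (v, w)).
Proof. by case: b => b /= /asboolP[]. Qed.

Lemma bform_linr (b : bform) v : linear (fun w => b (v, w)).
Proof. by case: b => b /= /asboolP[]. Qed.

Definition mk_bform (b : V * W -> K^o) (ll : forall w, linear (fun v => b (v, w)))
    (lr : forall v, linear (fun w => b (v, w))) (sb : smooth b) : bform :=
  @BForm b (asboolT (And3 ll lr sb)).

(* The functional diffeology. *)
HB.instance Definition _ := isDiffeological.Build R bform
  (@fun_open R (V * W)%type K^o bform bform_fun)
  (@fun_ext R (V * W)%type K^o bform bform_fun)
  (@fun_cst R (V * W)%type K^o bform bform_fun bform_smooth)
  (@fun_local R (V * W)%type K^o bform bform_fun)
  (@fun_comp R (V * W)%type K^o bform bform_fun).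

Lemma bform_add_smooth : smooth (fun x : bform * bform => x.1 + x.2).
Proof.
move=> n U p [[oU p1] [_ p2]]; split=> // m U' f q Cf fU qU.
by apply: plotD; [exact: p1|exact: p2].
Qed.

Lemma bform_scale_smooth : smooth (fun x : K * bform => x.1 *: x.2).
Proof.
move=> n U p [p1 [oU p2]]; split=> // m U' f q Cf fU qU.
apply: plotZ; last exact: p2.
exact: (plot_comp (plot_open qU) Cf fU p1).
Qed.

HB.instance Definition _ :=
  isDiffVect.Build R K bform bform_add_smooth bform_scale_smooth.

End SmoothBilinear.

Lemma linear_scale (K : pzRingType) (V W : lmodType K) (f : V -> W) :
  linear f -> forall a v, f (a *: v) = a *: f v.
Proof.
move=> lf a v; have f0 : f 0 = 0.
  by have := lf (-1) 0 0; rewrite scaler0 addr0 scaleN1r addNr.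
by have := lf a v 0; rewrite !addr0 f0 addr0.
Qed.

Section TensorProduct.
Variables (R : realType) (K : diffFieldType R) (V W : diffVectType K).

Let B : diffVectType K := bform V W.

Lemma eval_linear (v : V) (w : W) : linear (fun b : B => b (v, w) : K^o).
Proof. by move=> a b c. Qed.

Lemma eval_smooth (v : V) (w : W) : smooth (fun b : B => b (v, w) : K^o).
Proof.
move=> n U p [oU pU]; apply: (pU _ _ id (fun=> (v, w))) => //.
  exact: Cinfty_id.
by apply: plot_cst.
Qed.

(* v (x) w as the evaluation b |-> b (v, w), a smooth form on [bform V W]. *)
Definition dual_tens (v : V) (w : W) : slin B K^o :=
  mk_slin (@eval_linear v w) (@eval_smooth v w).

Definition tens_span : {pred slin B K^o} := fun t =>
  `[< exists n (a : 'I_n -> K) (v : 'I_n -> V) (w : 'I_n -> W),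
        t = \sum_i a i *: dual_tens (v i) (w i) >].

Record tensor := Tensor { tensor_val : slin B K^o ; _ : tensor_val \in tens_span }.

HB.instance Definition _ := [isSub for tensor_val].
HB.instance Definition _ := [Choice of tensor by <:].

Lemma tens_span_submod : submod_closed tens_span.
Proof.
split=> [|c s t /asboolP[m [a [v [w ->]]]] /asboolP[n [b [x [y ->]]]]].
  apply/asboolP; exists 0%N, (fun=> 0), (fun=> 0), (fun=> 0).
  by rewrite big_ord0.
pose glue T (f : 'I_m -> T) (g : 'I_n -> T) (i : 'I_(m + n)) :=
  match fintype.split i with inl j => f j | inr j => g j end.
apply/asboolP; exists (m + n)%N, (glue _ (fun j => c * a j) b).
exists (glue _ v x), (glue _ w y).
rewrite big_split_ord scaler_sumr /=; congr (_ + _); apply: eq_bigr => i _.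
  by rewrite /glue -/(unsplit (inl i)) unsplitK scalerA.
by rewrite /glue -/(unsplit (inr i)) unsplitK.
Qed.

HB.instance Definition _ :=
  GRing.isSubmodClosed.Build K (slin B K^o) tens_span tens_span_submod.
HB.instance Definition _ := [SubChoice_isSubLmodule of tensor by <:].

Lemma dual_tens_span v w : dual_tens v w \in tens_span.
Proof.
apply/asboolP; exists 1%N, (fun=> 1), (fun=> v), (fun=> w).
by rewrite big_ord1 scale1r.
Qed.

Definition tens (v : V) (w : W) : tensor := Tensor (dual_tens_span v w).

Lemma tensor_valP (s t : tensor) :
  (forall b, tensor_val s b = tensor_val t b) -> s = t.
Proof. by move=> st; apply/val_inj/val_inj/funext. Qed.

Lemma tensD_l v v' w : tens (v + v') w = tens v w + tens v' w.
Proof.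
apply: tensor_valP => b; have := bform_linl b w 1 v v'.
by rewrite !scale1r.
Qed.

Lemma tensZ_l a v w : tens (a *: v) w = a *: tens v w.
Proof.
by apply: tensor_valP => b; exact: (linear_scale (bform_linl b w)).
Qed.

(* Coefficients are absorbed in the factors. *)
Lemma tensor_sumP (t : tensor) : exists n (v : 'I_n -> V) (w : 'I_n -> W),
  t = \sum_i tens (v i) (w i).
Proof.
have /asboolP[n [a [v [w tE]]]] := valP t.
exists n, (fun i => a i *: v i), w; apply/val_inj.
by rewrite tE raddf_sum; apply: eq_bigr => i _; rewrite tensZ_l.
Qed.

Definition tensor_plot n (U : set 'rV[R]_n) (p : 'rV[R]_n -> tensor) : Prop :=
  open U /\ forall x, U x -> exists (U' : set 'rV[R]_n) (k : nat)
    (v : 'I_k -> 'rV[R]_n -> V) (w : 'I_k -> 'rV[R]_n -> W),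
    [/\ open U', U' x, U' `<=` U,
        forall i, plot V U' (v i) /\ plot W U' (w i) &
        forall y, U' y -> p y = \sum_i tens (v i y) (w i y)].

Let tensor_open n (U : set 'rV[R]_n) p : tensor_plot U p -> open U.
Proof. by case. Qed.

Let tensor_ext n (U : set 'rV[R]_n) p q :
  (forall x, U x -> p x = q x) -> tensor_plot U p -> tensor_plot U q.
Proof.
move=> pq [oU pU]; split=> // x /pU [U' [k [v [w [oU' U'x sU vw pE]]]]].
by exists U', k, v, w; split=> // y U'y; rewrite -pq ?pE//; exact: sU.
Qed.

Let tensor_cst n (U : set 'rV[R]_n) (t : tensor) : open U -> tensor_plot U (fun=> t).
Proof.
move=> oU; split=> // x Ux; have [k [v [w ->]]] := tensor_sumP t.
exists U, k, (fun i => fun=> v i), (fun i => fun=> w i); split=> // i.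
by split; exact: plot_cst.
Qed.

Let tensor_local n (U : set 'rV[R]_n) p : open U ->
    (forall x, U x -> exists U', [/\ U' x, U' `<=` U & tensor_plot U' p]) ->
  tensor_plot U p.
Proof.
move=> oU pU; split=> // x /pU [U1 [U1x sU1 [oU1 /(_ _ U1x)]]].
move=> [U' [k [v [w [oU' U'x sU vw pE]]]]]; exists U', k, v, w; split=> //.
exact: subset_trans sU sU1.
Qed.

Let tensor_comp m n (U : set 'rV[R]_m) (U' : set 'rV[R]_n)
    (f : 'rV[R]_m -> 'rV[R]_n) p :
  open U -> Cinfty U f -> (forall x, U x -> U' (f x)) ->
  tensor_plot U' p -> tensor_plot U (p \o f).
Proof.
move=> oU Cf fU [oU' pU]; split=> // x Ux.
have [U1 [k [v [w [oU1 U1x sU vw pE]]]]] := pU _ (fU _ Ux).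
have [oU2 sU2] := open_preimage_smooth oU Cf oU1.
have Cf2 : Cinfty (U `&` f @^-1` U1) f.
  by move=> j; apply: Ck_sub sU2 _; exact: Cf.
have f2 y : (U `&` f @^-1` U1) y -> U1 (f y) by case.
exists (U `&` f @^-1` U1), k, (fun i => v i \o f), (fun i => w i \o f); split=> //.
- by move=> i; split; apply: plot_comp f2 _ => //; have [] := vw i.
- by move=> y /f2 /pE.
Qed.

HB.instance Definition _ := isDiffeological.Build R tensor
  tensor_open tensor_ext tensor_cst tensor_local tensor_comp.

Lemma tensor_add_smooth : smooth (fun x : tensor * tensor => x.1 + x.2).
Proof.
move=> n U p [[oU p1] [_ p2]]; split=> // x Ux.
have [U1 [k1 [v1 [w1 [oU1 U1x sU1 vw1 pE1]]]]] := p1 _ Ux.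
have [U2 [k2 [v2 [w2 [oU2 U2x sU2 vw2 pE2]]]]] := p2 _ Ux.
pose glue T (f : 'I_k1 -> T) (g : 'I_k2 -> T) (i : 'I_(k1 + k2)) :=
  match fintype.split i with inl j => f j | inr j => g j end.
have oI : open (U1 `&` U2) by exact: openI.
have sI1 : U1 `&` U2 `<=` U1 by move=> ? [].
have sI2 : U1 `&` U2 `<=` U2 by move=> ? [].
exists (U1 `&` U2), (k1 + k2)%N, (glue _ v1 v2), (glue _ w1 w2); split=> //.
- by move=> y [/sU1].
- move=> i; rewrite /glue; case: fintype.split => j.
    by have [pv pw] := vw1 j; split; apply: (plot_sub oI sI1).
  by have [pv pw] := vw2 j; split; apply: (plot_sub oI sI2).
move=> y [U1y U2y] /=.
have := pE1 _ U1y; have := pE2 _ U2y => /= -> ->.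
rewrite big_split_ord /=; congr (_ + _); apply: eq_bigr => i _.
  by rewrite /glue -/(unsplit (inl i)) unsplitK.
by rewrite /glue -/(unsplit (inr i)) unsplitK.
Qed.

Lemma tensor_scale_smooth : smooth (fun x : K * tensor => x.1 *: x.2).
Proof.
move=> n U p [p1 [oU p2]]; split=> // x Ux.
have [U' [k [v [w [oU' U'x sU vw pE]]]]] := p2 _ Ux.
exists U', k, (fun i y => (p y).1 *: v i y), w; split=> //.
  move=> i; have [vi wi] := vw i; split=> //.
  apply: plotZ => //.
  exact: plot_sub p1.
move=> y U'y; have := pE _ U'y => /= ->; rewrite scaler_sumr.
by apply: eq_bigr => i _; rewrite tensZ_l.
Qed.

HB.instance Definition _ :=
  isDiffVect.Build R K tensor tensor_add_smooth tensor_scale_smooth.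

End TensorProduct.

Lemma slin_sumE (R : realType) (K : diffFieldType R) (V W : diffVectType K)
    n (f : 'I_n -> slin V W) x : (\sum_i f i) x = \sum_i f i x.
Proof.
have -> : slin_fun (\sum_i f i) = \sum_i slin_fun (f i).
  exact: (raddf_sum (\val : slin V W -> (V -> W))).
by rewrite fct_sumE.
Qed.

Lemma tensor_sumE (R : realType) (K : diffFieldType R) (V W : diffVectType K)
    n (t : 'I_n -> tensor V W) b :
  tensor_val (\sum_i t i) b = \sum_i tensor_val (t i) b.
Proof.
rewrite -slin_sumE; congr (slin_fun _ _).
exact: (raddf_sum (\val : tensor V W -> slin (bform V W) K^o)).
Qed.

Section TensorMap.
Variables (R : realType) (K : diffFieldType R) (V W W' : diffVectType K).

Lemma tens_linr (v : V) : linear (@tens R K V W v).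
Proof. by move=> a w w'; apply: tensor_valP => b; exact: bform_linr. Qed.

Lemma tens_linl (w : W) : linear (fun v : V => tens v w).
Proof. by move=> a v v'; rewrite tensD_l tensZ_l. Qed.

Lemma tens_smooth : smooth (fun x : V * W => tens x.1 x.2).
Proof.
move=> n U p [p1 p2]; have oU := plot_open p1; split=> // x Ux.
exists U, 1%N, (fun=> fst \o p), (fun=> snd \o p); split=> // y _.
by rewrite big_ord1.
Qed.

Variable f : slin W W'.

Lemma pull_linl (b : bform V W') w : linear (fun v : V => b (v, f w)).
Proof. exact: bform_linl. Qed.

Lemma pull_linr (b : bform V W') v : linear (fun w : W => b (v, f w)).
Proof. by move=> a w w'; rewrite linearP; exact: bform_linr. Qed.

Lemma pull_smooth (b : bform V W') : smooth (fun x : V * W => b (x.1, f x.2)).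
Proof.
move=> n U p [p1 p2].
by apply: (@bform_smooth _ _ _ _ b _ U (fun x => ((p x).1, f (p x).2)));
  split=> //; exact: (slin_smooth f p2).
Qed.

Definition pull (b : bform V W') : bform V W :=
  @mk_bform R K V W (fun x => b (x.1, f x.2))
    (pull_linl b) (pull_linr b) (@pull_smooth b).

Lemma pull_linear : linear pull.
Proof. by move=> a b c; apply/val_inj. Qed.

Lemma pull_slin_smooth : smooth pull.
Proof.
move=> n U p [oU pU]; split=> // m U' g q Cg gU [q1 q2].
apply: (pU m U' g (fun x => ((q x).1, f (q x).2)) Cg gU).
by split=> //; exact: (slin_smooth f q2).
Qed.

Lemma push_linear (t : tensor V W) :
  linear (fun b : bform V W' => tensor_val t (pull b)).
Proof. by move=> a b c; rewrite pull_linear linearP. Qed.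

Lemma push_smooth (t : tensor V W) :
  smooth (fun b : bform V W' => tensor_val t (pull b)).
Proof. exact: (smooth_comp pull_slin_smooth (slin_smooth (tensor_val t))). Qed.

(* The transpose of [b |-> b \o (id, f)] on the smooth dual. *)
Definition push (t : tensor V W) : slin (bform V W') K^o :=
  mk_slin (push_linear t) (@push_smooth t).

Lemma push_tens n (v : 'I_n -> V) (w : 'I_n -> W) :
  push (\sum_i tens (v i) (w i)) = tensor_val (\sum_i tens (v i) (f (w i))).
Proof.
by apply/val_inj/funext => b /=; rewrite !tensor_sumE.
Qed.

Lemma push_span t : push t \in @tens_span R K V W'.
Proof.
have [n [v [w ->]]] := tensor_sumP t; rewrite push_tens.
exact: valP.
Qed.

Definition tmap_fun (t : tensor V W) : tensor V W' := Tensor (push_span t).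

Lemma tmap_sum n (v : 'I_n -> V) (w : 'I_n -> W) :
  tmap_fun (\sum_i tens (v i) (w i)) = \sum_i tens (v i) (f (w i)).
Proof. by apply/val_inj; rewrite /= push_tens. Qed.

Lemma tmap_linear : linear tmap_fun.
Proof. by move=> a s t; apply: tensor_valP. Qed.

Lemma tmap_smooth : smooth tmap_fun.
Proof.
move=> n U p [oU pU]; split=> // x Ux.
have [U' [k [v [w [oU' U'x sU vw pE]]]]] := pU _ Ux.
exists U', k, v, (fun i => f \o w i); split=> //.
  by move=> i; have [vi wi] := vw i; split=> //; exact: (slin_smooth f wi).
by move=> y /pE /= ->; rewrite tmap_sum.
Qed.

(* The map id (x) f induced on tensor products. *)
Definition tmap : slin (tensor V W) (tensor V W') :=
  mk_slin tmap_linear tmap_smooth.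

Lemma tmap_tens v w : tmap (tens v w) = tens v (f w).
Proof. by have := tmap_sum (fun _ : 'I_1 => v) (fun=> w); rewrite !big_ord1. Qed.

End TensorMap.

Section TensorPowers.
Variables (R : realType) (K : diffFieldType R) (V : diffVectType K).

(* [tpow1 n] is the (n+1)-st tensor power. *)
Fixpoint tpow1 (n : nat) : diffVectType K :=
  if n is n'.+1 then tensor V (tpow1 n') else V.

Definition tpow (n : nat) : diffVectType K :=
  if n is n'.+1 then tpow1 n' else K^o.

Lemma scale_slin_linear (a : K) : linear (fun v : V => a *: v).
Proof. by move=> b v w; rewrite scalerDr !scalerA mulrC. Qed.

Lemma scale_slin_smooth (a : K) : smooth (fun v : V => a *: v).
Proof. by move=> n U p pU; apply: plotZ => //; exact/plot_cst/(plot_open pU). Qed.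

Lemma tens_right_smooth (W : diffVectType K) (w : W) :
  smooth (fun v : V => tens v w).
Proof.
move=> n U p pU; apply: (@tens_smooth _ _ V W _ U (fun x => (p x, w))).
by split=> //; exact/plot_cst/(plot_open pU).
Qed.

Definition tens_right j : tpow j -> slin V (tpow1 j) :=
  match j return tpow j -> slin V (tpow1 j) with
  | 0 => fun a => mk_slin (scale_slin_linear a) (scale_slin_smooth a)
  | j'.+1 => fun t => mk_slin (tens_linl t) (tens_right_smooth t)
  end.

Fixpoint concat1 i j (t : tpow j) : slin (tpow1 i) (tpow1 (i + j)) :=
  match i return slin (tpow1 i) (tpow1 (i + j)) with
  | 0 => tens_right t
  | i'.+1 => tmap V (concat1 i' t)
  end.

(* The bilinear map induced by concatenation: it is determined by [concat0s],
   [concats0], [concat1s] and [concat_tens] below. *)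
Definition concat i j : tpow i -> tpow j -> tpow (i + j) :=
  match i return tpow i -> tpow j -> tpow (i + j) with
  | 0 => fun a t => (a : K) *: t
  | i'.+1 => fun s t => concat1 i' t s
  end.

Definition tcast m n (e : m = n) (t : tpow m) : tpow n := ecast k (tpow k) e t.

Lemma concat0s j (a : tpow 0) (t : tpow j) : concat a t = (a : K) *: t.
Proof. by []. Qed.

Lemma concat1s j (v : tpow 1) (t : tpow j.+1) : concat v t = tens (v : V) t.
Proof. by []. Qed.

Lemma concat_tens i j (v : V) (s : tpow i.+1) (t : tpow j) :
  concat (tens v s : tpow i.+2) t = tens v (concat s t).
Proof. exact: tmap_tens. Qed.

Let tcast_tens m n (e1 : m.+1 = n.+1) (e2 : m.+2 = n.+2) (v : V) (s : tpow m.+1) :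
  tcast e2 (tens v s) = tens v (tcast e1 s) :> tpow n.+2.
Proof.
have mn : m = n by case: e1.
by move: e1 e2; case: n / mn => e1 e2; rewrite !eq_axiomK.
Qed.

Let tcast_sum m n (e : m = n) k (f : 'I_k -> tpow m) :
  tcast e (\sum_i f i) = \sum_i tcast e (f i).
Proof. by case: n / e. Qed.

Lemma concats0 i (s : tpow i) (a : tpow 0) :
  tcast (addn0 i) (concat s a) = (a : K) *: s.
Proof.
case: i s => [|i] s.
  by rewrite eq_axiomK; exact: mulrC.
change (tcast (addn0 i.+1) (concat1 i a s : tpow (i + 0).+1) = (a : K) *: s).
move: (addn0 i.+1) => e; elim: i s e => [|i IH] s e.
  by rewrite eq_axiomK.
have [n [v [w ->]]] := tensor_sumP s.
have -> : concat1 i.+1 a (\sum_i0 tens (v i0) (w i0)) =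
    \sum_i0 tens (v i0) (concat1 i a (w i0)) by exact: tmap_sum.
rewrite tcast_sum scaler_sumr; apply: eq_bigr => k _.
have e1 : (i + 0).+1 = i.+1 by rewrite addn0.
rewrite (tcast_tens e1) IH; exact: (linear_scale (@tens_linr _ _ _ _ _)).
Qed.

Lemma concat_linear_l i j (t : tpow j) : linear (fun s : tpow i => concat s t).
Proof.
case: i => [|i] a s s' /=; last exact: linearP.
by rewrite scalerDl scalerA.
Qed.

Lemma concat_linear_r i j (s : tpow i) : linear (fun t : tpow j => concat s t).
Proof.
case: i s => [|i] s a t t' /=.
  by rewrite scalerDr !scalerA mulrC.
elim: i s => [|i IH] s /=.
  case: j t t' => [|j] t t' /=; last exact: tens_linr.
  by rewrite scalerDl scalerA.
have [n [v [w ->]]] := tensor_sumP s.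
rewrite !tmap_sum scaler_sumr -big_split; apply: eq_bigr => k _ /=.
by rewrite IH; exact: tens_linr.
Qed.

End TensorPowers.

Section PowerSeries.
Variables (R : realType) (K : diffFieldType R) (V : diffVectType K).

(* K (+) prod_(k >= 1) V^(x)k, with K = [tpow V 0] as the degree-0 factor. *)
Definition tseries : Type := forall n, tpow V n.

HB.instance Definition _ := gen_eqMixin tseries.
HB.instance Definition _ := gen_choiceMixin tseries.

Let ts0 : tseries := fun=> 0.
Let tsopp (a : tseries) : tseries := fun n => - a n.
Let tsadd (a b : tseries) : tseries := fun n => a n + b n.
Let tsscale (k : K) (a : tseries) : tseries := fun n => k *: a n.

Let tsaddA : associative tsadd.
Proof. by move=> a b c; apply: functional_extensionality_dep => n; exact: addrA. Qed.
Let tsaddC : commutative tsadd.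
Proof. by move=> a b; apply: functional_extensionality_dep => n; exact: addrC. Qed.
Let tsadd0 : left_id ts0 tsadd.
Proof. by move=> a; apply: functional_extensionality_dep => n; exact: add0r. Qed.
Let tsaddN : left_inverse ts0 tsopp tsadd.
Proof. by move=> a; apply: functional_extensionality_dep => n; exact: addNr. Qed.

HB.instance Definition _ :=
  GRing.isZmodule.Build tseries tsaddA tsaddC tsadd0 tsaddN.

Let tsscaleA a b v : tsscale a (tsscale b v) = tsscale (a * b) v.
Proof. by apply: functional_extensionality_dep => n; exact: scalerA. Qed.
Let tsscale1 : left_id 1 tsscale.
Proof. by move=> v; apply: functional_extensionality_dep => n; exact: scale1r. Qed.
Let tsscaleDr : right_distributive tsscale +%R.
Proof. by move=> a v w; apply: functional_extensionality_dep => n; exact: scalerDr. Qed.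
Let tsscaleDl v : {morph tsscale^~ v : a b / a + b}.
Proof. by move=> a b; apply: functional_extensionality_dep => n; exact: scalerDl. Qed.

HB.instance Definition _ := GRing.Zmodule_isLmodule.Build K tseries
  tsscaleA tsscale1 tsscaleDr tsscaleDl.

HB.instance Definition _ := isDiffeological.Build R tseries
  (@dprod_open R nat (tpow V)) (@dprod_ext R nat (tpow V))
  (@dprod_cst R nat (tpow V)) (@dprod_local R nat (tpow V))
  (@dprod_comp R nat (tpow V)).

Definition tsmul (a b : tseries) : tseries := fun n =>
  \sum_(i < n.+1) tcast (subnKC (ltn_ord i : (i <= n)%N)) (concat (a i) (b (n - i)%N)).

Definition tsconst (l : K) : tseries := fun n =>
  match n return tpow V n with 0 => l | _.+1 => 0 end.

Definition tsone : tseries := tsconst 1.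

(* The factor prod_(k >= 1) V^(x)k of [tseries]. *)
Definition tspos : set tseries := [set t | t 0%N = 0].

End PowerSeries.

Arguments tsconst {R K} V l.
Arguments tspos {R K} V _.

Section DiffeologicalAlgebra.
Variables (R : realType) (K : diffFieldType R).

Record diffeological_algebra (A : diffLmodType R K) (mul : A -> A -> A) (one : A) :
    Prop := {
  alg_mulA : associative mul;
  alg_mul1r : left_id one mul;
  alg_mulr1 : right_id one mul;
  alg_mulDl : left_distributive mul +%R;
  alg_mulDr : right_distributive mul +%R;
  alg_scaleAl : forall k a b, k *: mul a b = mul (k *: a) b;
  alg_scaleAr : forall k a b, k *: mul a b = mul a (k *: b);
  alg_add_smooth : smooth (fun x : A * A => x.1 + x.2);
  alg_mul_smooth : smooth (fun x : A * A => mul x.1 x.2);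
  alg_scale_smooth : smooth (fun x : K * A => x.1 *: x.2)
}.

Record diffeological_group (G : diffType R) (mul : G -> G -> G) (one : G)
    (inv : G -> G) : Prop := {
  grp_mulA : associative mul;
  grp_mul1g : left_id one mul;
  grp_mulg1 : right_id one mul;
  grp_mulVg : left_inverse one inv mul;
  grp_mulgV : right_inverse one inv mul;
  grp_mul_smooth : smooth (fun x : G * G => mul x.1 x.2);
  grp_inv_smooth : smooth inv
}.

End DiffeologicalAlgebra.

(* The invertible elements of the monoid (T, mul, one). *)
Definition units (T : Type) (mul : T -> T -> T) (one : T) : set T :=
  [set a | exists b, mul a b = one /\ mul b a = one].

(* Main.v *)
(* A series is invertible iff its degree-0 component a0 is: with
   u = 1 - a0^-1 a, which has no component of degree 0, the inverse of a is
   a0^-1 times the geometric series of u. In degree n only the powers u^k with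
   k <= n contribute, so each component of the inverse is a finite expression
   in smooth operations; hence inversion is smooth for the infinite product
   diffeology. *)
From HB Require Import structures.
From mathcomp Require Import all_boot all_order all_algebra.
From mathcomp Require Import all_classical all_reals all_analysis.
Require Import Defs.
Import GRing.Theory numFieldNormedType.Exports.
Local Open Scope classical_set_scope.
Local Open Scope ring_scope.

Set Implicit Arguments.
Unset Strict Implicit.
Unset Printing Implicit Defensive.

(** * Linear maps and finite sums of plots *)

Lemma linear_bigsum (K : pzRingType) (V W : lmodType K) (f : V -> W) :
  linear f -> forall I (r : seq I) (P : pred I) (F : I -> V),
  f (\sum_(i <- r | P i) F i) = \sum_(i <- r | P i) f (F i).
Proof.
move=> lf I r P F.
exact: (linear_sum (HB.pack f (GRing.isLinear.Build _ _ _ _ f lf) : {linear V -> W})).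
Qed.

Lemma linear_zero (K : pzRingType) (V W : lmodType K) (f : V -> W) :
  linear f -> f 0 = 0.
Proof. by move=> lf; rewrite -(scale0r 0) (linear_scale lf) scale0r. Qed.

Lemma plot_sum (R : realType) (K : diffFieldType R) (W : diffVectType K) n
    (U : set 'rV[R]_n) (I : Type) (r : seq I) (f : I -> 'rV[R]_n -> W) :
  open U -> (forall i, plot W U (f i)) ->
  plot W U (fun x => \sum_(i <- r) f i x).
Proof.
move=> oU pf; elim: r => [|i r IH].
  by apply: plot_ext (plot_cst 0 oU) => x _; rewrite big_nil.
by apply: plot_ext (plotD (pf i) IH) => x _; rewrite big_cons.
Qed.

(** * Smoothness and associativity of concatenation *)

Section TensorPowers.
Variables (R : realType) (K : diffFieldType R) (V : diffVectType K).
Notation T := (tpow V).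

Lemma tcast_linear m n (e : m = n) : linear (@tcast R K V m n e).
Proof. by case: n / e. Qed.

Lemma tcast_tens m n (e1 : m.+1 = n.+1) (e2 : m.+2 = n.+2) (v : V) (s : T m.+1) :
  tcast e2 (tens v s : T m.+2) = tens v (tcast e1 s) :> T n.+2.
Proof.
have mn : m = n by case: e1.
by move: e1 e2; case: n / mn => e1 e2; rewrite !eq_axiomK.
Qed.

Lemma tcast_smooth m n (e : m = n) : smooth (@tcast R K V m n e).
Proof. by case: n / e. Qed.

(** By induction on [i]: a plot of a tensor power is locally a finite sum of [tens v w], and
    concatenation on the right only affects [w], which has one degree less. *)
Lemma concat_smooth i j : smooth (fun x : T i * T j => concat x.1 x.2).
Proof.
case: i => [|i]; first exact: vscale_smooth.
elim: i => [|i IH].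
  case: j => [|j]; last exact: tens_smooth.
  by move=> n U p [p1 p2]; exact: (plotZ p2 p1).
move=> n U p [[oU p1] p2]; apply: plot_local => // x Ux.
have [U' [k [v [w [oU' U'x sU vw pE]]]]] := p1 _ Ux.
exists U'; split=> //.
apply: (@plot_ext _ _ _ _ (fun y => \sum_(l < k)
    (tens (v l y) (concat (w l y : T i.+1) (p y).2) : T (i.+2 + j)))).
  move=> y U'y /=; have := pE _ U'y => /= ->.
  by rewrite tmap_sum.
apply: plot_sum => // l; have [vl wl] := vw l.
apply: (@tens_smooth _ _ V (T (i.+1 + j)) _ U'
  (fun y => (v l y, concat (w l y : T i.+1) (p y).2))).
split=> //.
by apply: (IH _ U' (fun y => (w l y : T i.+1, (p y).2))); split=> //; exact: plot_sub p2.
Qed.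

Lemma concat_sum_tens i j n (v : 'I_n -> V) (w : 'I_n -> T i.+1) (t : T j) :
  concat (\sum_l tens (v l) (w l) : T i.+2) t =
  \sum_l (tens (v l) (concat (w l) t) : T (i.+2 + j)).
Proof. exact: tmap_sum. Qed.

(** By induction on [i]: both sides are additive in [s], which reduces the claim to [tens v w],
    where concatenation passes to [w]. *)
Lemma concatA i j k (e : (i + j + k)%N = (i + (j + k))%N)
    (s : T i) (t : T j) (u : T k) :
  tcast e (concat (concat s t) u) = concat s (concat t u).
Proof.
case: i e s => [|i] e s.
  rewrite eq_axiomK.
  exact: (linear_scale (@concat_linear_l R K V j k u) (s : K) t).
elim: i e s => [|i IH] e s.
  (* A degree-0 [t] is a scalar, so [concat] on it is scaling and needs its own case. *)
  case: j e t => [|j] e t.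
    rewrite eq_axiomK.
    etransitivity.
      exact: (linear_scale (@concat_linear_l R K V 1 k u) (t : K) s).
    symmetry; exact: (linear_scale (@concat_linear_r R K V 1 k s) (t : K) u).
  rewrite eq_axiomK.
  exact: (concat_tens (s : V) t u).
have [n [v [w ->]]] := tensor_sumP s.
rewrite (concat_sum_tens v w) (concat_sum_tens v w).
rewrite (@concat_sum_tens (i + j) k n v (fun l => concat (w l : T i.+1) t)).
rewrite (linear_bigsum (tcast_linear e)); apply: eq_bigr => l _.
(* The degree equation for [w], one lower than [e]; [tcast_tens] moves the cast inside [tens v]. *)
have e1 : (i.+1 + j + k)%N = (i.+1 + (j + k))%N by rewrite addnA.
rewrite -(IH e1).
exact: (@tcast_tens (i + j + k) (i + (j + k)) e1 e).
Qed.

(* The cast into degree n, extended by 0 to the other degrees, which allows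
   convolutions to be written as plain double sums. *)
Definition tproj m n (t : T m) : T n :=
  if m =P n is ReflectT e then tcast e t else 0.

Lemma tprojE m n (e : m = n) (t : T m) : tproj n t = tcast e t.
Proof.
rewrite /tproj; case: eqP => [e'|//]; congr (tcast _ t).
exact: eq_irrelevance.
Qed.

Lemma tproj_neq m n (t : T m) : m != n -> tproj n t = 0.
Proof. by rewrite /tproj; case: eqP. Qed.

Lemma tproj_id n (t : T n) : tproj n t = t.
Proof. by rewrite (tprojE erefl). Qed.

Lemma tproj_tcast m m' n (e : m = m') (t : T m) : tproj n (tcast e t) = tproj n t.
Proof. by case: m' / e. Qed.

Lemma tproj_linear m n : linear (@tproj m n).
Proof.
rewrite /tproj => a s t; case: eqP => [e|_]; first exact: tcast_linear.
by rewrite scaler0 addr0.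
Qed.

(** For nested products: the degree condition on the inner factor becomes a test that a sum over [i]
    can absorb. *)
Lemma tproj_concat_l m i j n (s : T m) (t : T j) :
  tproj n (concat (tproj i s) t) = if m == i then tproj n (concat s t) else 0.
Proof.
have [e|ne] := eqVneq m i; first by case: i / e; rewrite tproj_id.
rewrite (tproj_neq _ ne) (linear_zero (concat_linear_l _)).
exact: linear_zero (@tproj_linear _ _).
Qed.

Lemma tproj_concat_r m i j n (s : T i) (t : T m) :
  tproj n (concat s (tproj j t)) = if m == j then tproj n (concat s t) else 0.
Proof.
have [e|ne] := eqVneq m j; first by case: j / e; rewrite tproj_id.
rewrite (tproj_neq _ ne) (linear_zero (concat_linear_r _)).
exact: linear_zero (@tproj_linear _ _).
Qed.

Lemma tproj_concatA i j k n (s : T i) (t : T j) (u : T k) :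
  tproj n (concat (concat s t) u) = tproj n (concat s (concat t u)).
Proof.
by rewrite -(concatA (esym (addnA i j k))) tproj_tcast.
Qed.

Lemma tproj_concat_one_l j n (t : T j) :
  tproj n (concat (1 : T 0) t) = tproj n t.
Proof. by congr (tproj n _); exact: scale1r. Qed.

Lemma tproj_concat_one_r i n (s : T i) :
  tproj n (concat s (1 : T 0)) = tproj n s.
Proof.
by rewrite -[in RHS](scale1r s) -(@concats0 _ _ _ i s 1) tproj_tcast.
Qed.

End TensorPowers.

(** * The Cauchy product as an associative unital bilinear product *)

Section PowerSeries.
Variables (R : realType) (K : diffFieldType R) (V : diffVectType K).
Notation T := (tpow V).
Notation A := (tseries V).

Lemma tseriesP (a b : A) : (forall n, a n = b n) -> a = b.
Proof. exact: functional_extensionality_dep. Qed.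

Lemma tseries_sumE I (r : seq I) (F : I -> A) n :
  (\sum_(i <- r) F i) n = \sum_(i <- r) F i n.
Proof. exact: (big_morph (fun a : A => a n)). Qed.

(** Pairs with i + j different from n project to 0. The ranges no longer depend on n, so nested sums
    can be exchanged freely. *)
Lemma tsmulE N n (a b : A) : (n <= N)%N ->
  tsmul a b n = \sum_(i < N.+1) \sum_(j < N.+1) tproj n (concat (a i) (b j)).
Proof.
move=> nN.
transitivity (\sum_(i < n.+1) tproj n (concat (a i) (b (n - i)%N))).
  by apply: eq_bigr => i _; rewrite (tprojE (subnKC (ltn_ord i : (i <= n)%N))).
rewrite (big_ord_widen N.+1 (fun i => tproj n (concat (a i) (b (n - i)%N)))) //.
rewrite big_mkcond; apply: eq_bigr => i _; rewrite ltnS; case: leqP => hi.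
  have lt : (n - i < N.+1)%N by rewrite ltnS (leq_trans (leq_subr _ _)).
  rewrite (bigD1 (Ordinal lt)) //= big1 ?addr0 // => j; rewrite -val_eqE /= => jn.
  by apply: tproj_neq; apply: contraNneq jn => <-; rewrite addKn.
rewrite big1 // => j _; apply: tproj_neq.
by rewrite gtn_eqF // (leq_trans hi) // leq_addr.
Qed.

Lemma tsmul_assoc : associative (@tsmul R K V).
Proof.
move=> a b c; apply: tseriesP => n.
(* Both bracketings become the same triple sum once the intermediate degree [m] is summed away. A
   degree [d] above [n] is missed by the range, hence the vanishing condition on [x]. *)
have pick d (x : T n) : (~~ (d <= n)%N -> x = 0) ->
    \sum_(m < n.+1) (if d == m then x else 0) = x.
  move=> x0; have [dn|nd] := boolP (d <= n)%N.
    rewrite (bigD1 (Ordinal (dn : (d < n.+1)%N))) //= eqxx big1 ?addr0 // => m.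
    by rewrite -val_eqE /= eq_sym => /negbTE ->.
  by rewrite x0 // big1 // => m _; case: ifP.
transitivity (\sum_(i < n.+1) \sum_(j < n.+1) \sum_(k < n.+1)
    tproj n (concat (a i) (concat (b j) (c k)))).
  rewrite (tsmulE _ _ (leqnn n)); apply: eq_bigr => i _.
  transitivity (\sum_(m < n.+1) \sum_(j < n.+1) \sum_(k < n.+1)
      if (j + k)%N == m then tproj n (concat (a i) (concat (b j) (c k))) else 0).
    apply: eq_bigr => m _; rewrite (tsmulE _ _ (ltn_ord m : (m <= n)%N)).
    rewrite (linear_bigsum (concat_linear_r _)) (linear_bigsum (@tproj_linear _ _ _ _ _)).
    apply: eq_bigr => j _.
    rewrite (linear_bigsum (concat_linear_r _)) (linear_bigsum (@tproj_linear _ _ _ _ _)).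
    by apply: eq_bigr => k _; rewrite tproj_concat_r.
  rewrite exchange_big; apply: eq_bigr => j _.
  rewrite exchange_big; apply: eq_bigr => k _.
  apply: pick => jk; apply: tproj_neq; apply: contra jk => /eqP ijk.
  by have := leq_addl i (j + k); rewrite ijk.
symmetry; rewrite (tsmulE _ _ (leqnn n)).
transitivity (\sum_(m < n.+1) \sum_(k < n.+1) \sum_(i < n.+1) \sum_(j < n.+1)
    if (i + j)%N == m then tproj n (concat (a i) (concat (b j) (c k))) else 0).
  apply: eq_bigr => m _; apply: eq_bigr => k _.
  rewrite (tsmulE _ _ (ltn_ord m : (m <= n)%N)).
  rewrite (linear_bigsum (concat_linear_l _)) (linear_bigsum (@tproj_linear _ _ _ _ _)).
  apply: eq_bigr => i _.
  rewrite (linear_bigsum (concat_linear_l _)) (linear_bigsum (@tproj_linear _ _ _ _ _)).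
  by apply: eq_bigr => j _; rewrite tproj_concat_l tproj_concatA.
rewrite exchange_big.
(* The sum over [m] is moved innermost, past [k], [i] and [j], where [pick] collapses it. *)
under eq_bigr => k _.
  rewrite exchange_big; under eq_bigr => i _.
    rewrite exchange_big; under eq_bigr => j _.
      rewrite pick; last first.
        move=> ij; apply: tproj_neq; apply: contra ij => /eqP ijk.
        by have := leq_addr k (i + j); rewrite -addnA ijk.
      over.
    over.
  over.
rewrite exchange_big; apply: eq_bigr => i _; exact: exchange_big.
Qed.

Lemma tsmul_1l : left_id (tsone V) (@tsmul R K V).
Proof.
move=> a; apply: tseriesP => n.
rewrite (tsmulE _ _ (leqnn n)) big_ord_recl [X in _ + X]big1 ?addr0 => [|i _]; last first.
  rewrite big1 // => j _; have -> : tsone V (lift ord0 i) = 0 by [].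
  rewrite (linear_zero (concat_linear_l _)).
  exact: linear_zero (@tproj_linear _ _ _ _ _).
rewrite big_ord_recr big1 => [|j _].
  by rewrite [LHS]add0r tproj_concat_one_l tproj_id.
by rewrite tproj_concat_one_l tproj_neq // neq_ltn /= ltn_ord.
Qed.

Lemma tsmul_1r : right_id (tsone V) (@tsmul R K V).
Proof.
move=> a; apply: tseriesP => n.
rewrite (tsmulE _ _ (leqnn n)) exchange_big /= big_ord_recl.
rewrite [X in _ + X]big1 ?addr0 => [|i _]; last first.
  rewrite big1 // => j _; have -> : tsone V (lift ord0 i) = 0 by [].
  rewrite (linear_zero (concat_linear_r _)).
  exact: linear_zero (@tproj_linear _ _ _ _ _).
rewrite big_ord_recr big1 => [|j _].
  by rewrite [LHS]add0r tproj_concat_one_r tproj_id.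
by rewrite tproj_concat_one_r tproj_neq // neq_ltn /= ltn_ord.
Qed.

Lemma tsmul_linear_l b : linear (fun a : A => tsmul a b).
Proof.
move=> k a a'; apply: tseriesP => n.
change (tsmul (k *: a + a') b n = k *: tsmul a b n + tsmul a' b n).
rewrite /tsmul scaler_sumr -big_split; apply: eq_bigr => i _.
etransitivity; last exact: tcast_linear.
congr tcast; exact: concat_linear_l.
Qed.

Lemma tsmul_linear_r a : linear (fun b : A => tsmul a b).
Proof.
move=> k b b'; apply: tseriesP => n.
change (tsmul a (k *: b + b') n = k *: tsmul a b n + tsmul a b' n).
rewrite /tsmul scaler_sumr -big_split; apply: eq_bigr => i _.
etransitivity; last exact: tcast_linear.
congr tcast; exact: concat_linear_r.
Qed.

Lemma tsmulDl : left_distributive (@tsmul R K V) +%R.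
Proof. by move=> a a' b; have := tsmul_linear_l b 1 a a'; rewrite !scale1r. Qed.

Lemma tsmulDr : right_distributive (@tsmul R K V) +%R.
Proof. by move=> a b b'; have := tsmul_linear_r a 1 b b'; rewrite !scale1r. Qed.

HB.instance Definition _ := GRing.Zmodule_isPzRing.Build A
  tsmul_assoc tsmul_1l tsmul_1r tsmulDl tsmulDr.

(** * Smoothness of the algebra operations *)

Lemma tseries_add_smooth : smooth (fun x : A * A => x.1 + x.2).
Proof.
move=> n U p [[oU p1] [_ p2]]; split=> // i.
exact: (plotD (p1 i) (p2 i)).
Qed.

Lemma tseries_scale_smooth : smooth (fun x : K * A => x.1 *: x.2).
Proof. by move=> n U p [p1 [oU p2]]; split=> // i; exact: (plotZ p1 (p2 i)). Qed.

HB.instance Definition _ :=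
  isDiffVect.Build R K A tseries_add_smooth tseries_scale_smooth.

Lemma tsmul_smooth : smooth (fun x : A * A => tsmul x.1 x.2).
Proof.
move=> n U p [[oU p1] [_ p2]]; split=> // i; apply: plot_sum => // j.
apply: (@tcast_smooth _ _ _ _ _ (subnKC (ltn_ord j : (j <= i)%N)) _ U
  (fun x => concat ((p x).1 j) ((p x).2 (i - j)%N))).
apply: (@concat_smooth _ _ V j (i - j)%N _ U
  (fun x => ((p x).1 j, (p x).2 (i - j)%N))).
by split; [exact: p1|exact: p2].
Qed.

Lemma plotX n (U : set 'rV[R]_n) (p : 'rV[R]_n -> A) k :
  plot A U p -> plot A U (fun x => p x ^+ k).
Proof.
move=> pU; elim: k => [|k IH]; first exact/plot_cst/(plot_open pU).
apply: plot_ext (@tsmul_smooth _ U (fun x => (p x, p x ^+ k)) _).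
  by move=> x _; rewrite exprS.
by split.
Qed.

(** * Inversion by geometric series *)

Lemma tsmul0E (a b : A) : (a * b) 0%N = ((a 0%N : K) * (b 0%N : K)).
Proof. by rewrite [LHS]big_ord1 eq_axiomK. Qed.

Lemma eq_tsmul_r (a b c : A) n :
  (forall m, (m <= n)%N -> b m = c m) -> (a * b) n = (a * c) n.
Proof. by move=> bc; apply: eq_bigr => i _; rewrite bc // leq_subr. Qed.

(** In u * u^k the term i = 0 vanishes with [u 0]; a term with i > 0 involves u^k in degree n - i <
    k, where it vanishes by induction. *)
Lemma tseries_exp_low (u : A) k n : u 0%N = 0 -> (n < k)%N -> (u ^+ k) n = 0.
Proof.
move=> u0; elim: k n => // k IH n nk; rewrite exprS [LHS]big1 // => i _.
rewrite -[RHS](linear_zero (@tcast_linear _ _ V _ _ (subnKC (ltn_ord i : (i <= n)%N)))).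
congr tcast; case: i => [[|i] /= hi].
  by rewrite u0; exact: scale0r.
rewrite IH; first exact: (linear_zero (@concat_linear_r R K V i.+1 _ (u i.+1))).
by apply: leq_trans (nk : (n <= k)%N); rewrite ltn_subrL (leq_trans _ (hi : (i < n)%N)).
Qed.

(* The geometric series of [u]; for [u] in [tspos] the powers beyond the n-th
   do not contribute in degree n. *)
Definition tsgeom (u : A) : A := fun n => (\sum_(i < n.+1) u ^+ i) n.

(** One truncation serves all degrees up to [n], as [eq_tsmul_r] requires. *)
Lemma tsgeomE (u : A) m n : u 0%N = 0 -> (m <= n)%N ->
  tsgeom u m = (\sum_(i < n.+1) u ^+ i) m.
Proof.
move=> u0 mn; rewrite /tsgeom !tseries_sumE.
rewrite (big_ord_widen n.+1 (fun i => (u ^+ i) m)) // big_mkcond.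
apply: eq_bigr => i _; case: ltnP => // mi.
by rewrite (tseries_exp_low u0 mi).
Qed.

Lemma tsgeomP (u : A) : u 0%N = 0 -> (1 - u) * tsgeom u = 1.
Proof.
move=> u0; apply: tseriesP => n.
rewrite (eq_tsmul_r (1 - u) (fun m => tsgeomE u0)).
(* The product telescopes to 1 - u^(n+1), whose last term vanishes in degree n. *)
rewrite -opprB mulNr -subrX1 opprB.
change ((1 : A) n - (u ^+ n.+1) n = (1 : A) n).
by rewrite (tseries_exp_low u0 (ltnSn n)) subr0.
Qed.

Definition tsinv (a : A) : A :=
  (a 0%N : K)^-1 *: tsgeom (1 - (a 0%N : K)^-1 *: a).

Lemma tsinvr (a : A) : a 0%N != 0 -> a * tsinv a = 1.
Proof.
move=> a0; set u := 1 - (a 0%N : K)^-1 *: a.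
have u0 : u 0%N = 0.
  change ((1 : K) - (a 0%N : K)^-1 * (a 0%N : K) = 0).
  by rewrite mulVf // subrr.
(* Here 1 - u is a0^-1 a; bilinearity then moves the scalar to the right factor. *)
have := tsgeomP u0; rewrite {1}/u opprB addrCA subrr addr0 => <-.
rewrite [RHS](linear_scale (tsmul_linear_l _)).
exact: (linear_scale (tsmul_linear_r _)).
Qed.

Lemma tsinvl (a : A) : a 0%N != 0 -> tsinv a * a = 1.
Proof.
move=> a0; have ab := tsinvr a0.
have b0 : tsinv a 0%N != 0.
  apply/eqP => b0; have := oner_neq0 K; rewrite -[1]/((1 : A) 0%N) -ab tsmul0E b0.
  by rewrite mulr0 eqxx.
have bc := tsinvr b0.
(* With b = [tsinv a] and c = [tsinv b], a = a (b c) = (a b) c = c, so b a = b c = 1. *)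
by rewrite -{2}[a]mulr1 -bc (mulrA a) ab mul1r.
Qed.

Lemma units_tseriesE : units (@tsmul R K V) (tsone V) = [set a | a 0%N != 0].
Proof.
apply/seteqP; split=> a /=.
  move=> [b [ab _]]; apply/eqP => a0; have := oner_neq0 K.
  rewrite -[1]/((tsone V) 0%N) -ab [tsmul a b 0%N]tsmul0E a0.
  by rewrite mul0r eqxx.
by move=> a0; exists (tsinv a); split; [exact: tsinvr|exact: tsinvl].
Qed.

(** Nonvanishing is asked on the whole space, not just on [U], so that the degree-0 component is a
    total map into [nonzero K], the domain of [field_inv_smooth]. *)
Lemma tsinv_plot n (U : set 'rV[R]_n) (p : 'rV[R]_n -> A) :
  (forall x, p x 0%N != 0) -> plot A U p -> plot A U (fun x => tsinv (p x)).
Proof.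
move=> p0 pU; have [oU pUi] := pU.
have qU : plot K U (fun x => (p x 0%N : K)^-1).
  exact: (@field_inv_smooth R K n U
    (fun x => SigSub (mem_set (p0 x) : (p x 0%N : K) \in nonzero K)) (pUi 0%N)).
have uU : plot A U (fun x => 1 - (p x 0%N : K)^-1 *: p x).
  apply: plot_ext (plotD (plot_cst (1 : A) oU)
    (plotZ (plot_cst (-1 : K) oU) (plotZ qU pU))) => x _.
  by rewrite scaleN1r.
apply: plotZ qU _; split=> // i.
(* Coordinate [i] of [tsgeom] is that of a finite sum of powers, itself a plot of [A]; [.2] extracts
   its coordinates. *)
exact: (plot_sum (index_enum 'I_i.+1) oU (fun j => plotX j uU)).2.
Qed.

End PowerSeries.

Theorem theorem3p8 (R : realType) (K : diffFieldType R) (V : diffVectType K)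
    (sepV : separates_points V) :
  let Tx := units (@tsmul R K V) (tsone V) in
  [/\ diffeological_algebra (@tsmul R K V) (tsone V),
      Tx = [set tsconst V l + t | l in nonzero K & t in tspos V] &
      exists (mul : Tx -> Tx -> Tx) (one : Tx) (inv : Tx -> Tx),
        [/\ forall a b : Tx, val (mul a b) = tsmul (val a) (val b),
            val one = tsone V &
            diffeological_group mul one inv]].
Proof.
move=> Tx; split.
- split.
  + exact: tsmul_assoc.
  + exact: tsmul_1l.
  + exact: tsmul_1r.
  + exact: tsmulDl.
  + exact: tsmulDr.
  + by move=> k a b; rewrite (linear_scale (tsmul_linear_l b)).
  + by move=> k a b; rewrite (linear_scale (tsmul_linear_r a)).
  + exact: tseries_add_smooth.
  + exact: tsmul_smooth.
  + exact: tseries_scale_smooth.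
- rewrite /Tx units_tseriesE; apply/seteqP; split=> a /=.
    move=> a0; exists (a 0%N) => //.
    exists (a - tsconst V (a 0%N)); last by rewrite addrC subrK.
    exact: subrr.
  move=> [l l0 [t t0 <-]].
  change ((l : K) + (t 0%N : K) != 0).
  by rewrite [t 0%N]t0 addr0.
have TxE b : Tx b -> b 0%N != 0 by rewrite /Tx units_tseriesE.
have Tx0 (a : Tx) : val a 0%N != 0 by exact: TxE (set_valP a).
have inT (a : tseries V) : a 0%N != 0 -> a \in Tx.
  by move=> a0; apply/mem_set; rewrite /Tx units_tseriesE.
have mulT (a b : Tx) : tsmul (val a) (val b) \in Tx.
  by apply: inT; rewrite [X in X != _]tsmul0E mulf_neq0 // Tx0.
have oneT : tsone V \in Tx by apply: inT; exact: oner_neq0.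
have invT (a : Tx) : tsinv (val a) \in Tx.
  by apply/mem_set; exists (val a); split; [exact: tsinvl|exact: tsinvr].
exists (fun a b => SigSub (mulT a b)), (SigSub oneT), (fun a => SigSub (invT a)).
split=> //; split.
- by move=> a b c; apply: val_inj; exact: tsmul_assoc.
- by move=> a; apply: val_inj; exact: tsmul_1l.
- by move=> a; apply: val_inj; exact: tsmul_1r.
- by move=> a; apply: val_inj; exact: tsinvl.
- by move=> a; apply: val_inj; exact: tsinvr.
(* For the subset diffeology, a plot of [Tx] is a plot of series after [val], so both smoothness
   claims reduce to the ambient algebra. *)
- move=> n U p [p1 p2].
  exact: (@tsmul_smooth R K V n U (fun x => (val (p x).1, val (p x).2)) (conj p1 p2)).
- move=> n U p pU.
  exact: (@tsinv_plot R K V n U (fun x => val (p x)) (fun x => Tx0 (p x)) pU).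
Qed.
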